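(* An optimal list of one-dimensional subalgebras of the Lie algebra $\mathfrak g$ (with respect to the action of the group $G$) is exhausted by the subalgebras $$\langle\mathcal D+a\mathcal G+b\mathcal P^v+\mathcal W(\delta_1)\rangle,\quad \langle\mathcal G+\delta_2\mathcal P^t+b\mathcal P^v+\mathcal W(\delta_1)\rangle,\quad \langle\mathcal P^t+\delta_2\mathcal P^v+\mathcal W(\delta_1)\rangle,$$ $$\langle\mathcal P^x+\delta_2\mathcal P^v+\mathcal W(\delta_1)\rangle,\quad \langle\mathcal P^v+\mathcal W(\delta_1)\rangle,\quad \langle\mathcal W(1)\rangle,$$ where $\delta_1,\delta_2\in\{0,1\}$, and $a$ and $b$ are arbitrary constants.
   Context: $\mathfrak g$ is the maximal Lie invariance algebra of the system $u_t+uu_x+v_x=0$, $v_t+uv_x+u_x=0$, $w_t+uw_x=0$; it is spanned by the vector fields $\mathcal D=t\partial_t+x\partial_x$, $\mathcal G=t\partial_x+\partial_u$, $\mathcal P^t=\partial_t$, $\mathcal P^x=\partial_x$, $\mathcal P^v=\partial_v$ and $\mathcal W(\Omega)=\Omega(w)\partial_w$, where $\Omega$ runs through the smooth functions of $w$. $G$ is the group of point transformations $$\tilde t=T^1t+T^0,\ \tilde x=T^1x+T^1U^0t+X^0,\ \tilde u=u+U^0,\ \tilde v=v+V^0,\ \tilde w=W(w),$$ with arbitrary constants $T^0,T^1,X^0,U^0,V^0$, $T^1\ne0$, and $W$ a smooth function with $W_w\neq0$. $G$ acts on $\mathfrak g$ by pushforward of vector fields. An optimal list of subalgebras of a given dimension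 is a list of pairwise $G$-inequivalent subalgebras such that every subalgebra of that dimension is $G$-equivalent to one in the list. The consideration is local: a nonzero parameter function $\Omega$ is considered on an interval where it does not vanish, and transformations $w\mapsto W(w)$ are local diffeomorphisms. $\mathcal W(\delta_1)$ means $\mathcal W(\Omega)$ with the constant function $\Omega=\delta_1$. *)

(* Defs.v *)
(* Library world: MathComp-Analysis. *)
From mathcomp Require Import all_boot all_order all_algebra.
From mathcomp Require Import all_classical all_reals all_analysis.

Set Implicit Arguments.
Unset Strict Implicit.
Unset Printing Implicit Defensive.

Import Order.TTheory GRing.Theory Num.Theory.
Import numFieldNormedType.Exports.

Local Open Scope classical_set_scope.
Local Open Scope ring_scope.

(* Points of R^5 are row vectors, with coordinates in the order t, x, u, v, w;
   vector fields are maps sending a point to its vector of components. *)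
Definition it : 'I_5 := @Ordinal 5 0 isT.
Definition ix : 'I_5 := @Ordinal 5 1 isT.
Definition iu : 'I_5 := @Ordinal 5 2 isT.
Definition iv : 'I_5 := @Ordinal 5 3 isT.
Definition iw : 'I_5 := @Ordinal 5 4 isT.

Definition point (R : realType) := 'rV[R]_5.
Definition vfield (R : realType) := 'rV[R]_5 -> 'rV[R]_5.

Definition tuple5 (R : realType) (t x u v w : R) : 'rV[R]_5 :=
  \row_(i < 5) [:: t; x; u; v; w]`_i.

Definition partial (R : realType) (i : 'I_5) : 'rV[R]_5 := delta_mx 0 i.

Definition vD (R : realType) : vfield R :=
  fun p => p 0 it *: partial R it + p 0 ix *: partial R ix.
Definition vG (R : realType) : vfield R :=
  fun p => p 0 it *: partial R ix + partial R iu.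
Definition vPt (R : realType) : vfield R := fun=> partial R it.
Definition vPx (R : realType) : vfield R := fun=> partial R ix.
Definition vPv (R : realType) : vfield R := fun=> partial R iv.
Definition vW (R : realType) (Omega : R -> R) : vfield R :=
  fun p => Omega (p 0 iw) *: partial R iw.

Arguments vD R : clear implicits.
Arguments vG R : clear implicits.
Arguments vPt R : clear implicits.
Arguments vPx R : clear implicits.
Arguments vPv R : clear implicits.

(* Functions of w are total, but only their values on an open interval I are
   relevant.  Accordingly vector fields are considered on R^4 x I, and they are
   identified when they agree there. *)
Definition open_interval (R : realType) (I : set R) : Prop :=
  [/\ open I, is_interval I & I !=set0].

Definition dom (R : realType) (I : set R) : set (point R) :=
  [set p | I (p 0 iw)].

Definition smooth_on (R : realType) (I : set R) (f : R -> R) : Prop :=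
  forall (n : nat) (w : R), I w -> derivable (f^`(n))%classic w 1.

Definition agree (R : realType) (I : set R) (X Y : vfield R) : Prop :=
  forall p, dom I p -> X p = Y p.

Definition galg (R : realType) (I : set R) : set (vfield R) :=
  [set X | exists (d g a b c : R) (Omega : R -> R), smooth_on I Omega /\
     agree I X (d *: vD R + g *: vG R + a *: vPt R + b *: vPx R + c *: vPv R
                + vW Omega)].

Definition bracket (R : realType) (X Y : vfield R) : vfield R :=
  fun p => 'D_(X p) Y p - 'D_(Y p) X p.

Record subalgebra (R : realType) (I : set R) (L : set (vfield R)) : Prop := {
  subalgebra_sub : L `<=` galg I ;
  subalgebra_agree : forall X Y, agree I X Y -> L X -> L Y ;
  subalgebra0 : L 0 ;
  subalgebraD : forall X Y, L X -> L Y -> L (X + Y) ;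
  subalgebraZ : forall (c : R) X, L X -> L (c *: X) ;
  subalgebra_bracket : forall X Y, L X -> L Y -> L (bracket X Y) }.

Definition one_dimensional (R : realType) (I : set R) (L : set (vfield R)) :
    Prop :=
  exists X, [/\ L X, ~ agree I X 0 &
    forall Y, L Y -> exists c : R, agree I Y (c *: X)].

(* The w-component of an element of the algebra is its parameter function
   Omega.  The local point of view is that the interval I has been chosen so
   that Omega is either identically zero or nowhere zero on it. *)
Definition zero_or_nonvanishing (R : realType) (I : set R)
    (L : set (vfield R)) : Prop :=
  forall X, L X -> (forall p, dom I p -> X p 0 iw = 0) \/
                   (forall p, dom I p -> X p 0 iw != 0).

Definition one_dim_subalgebra (R : realType) (I : set R)
    (L : set (vfield R)) : Prop :=
  [/\ subalgebra I L, one_dimensional I L & zero_or_nonvanishing I L].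

Definition transf (R : realType) (T0 T1 X0 U0 V0 : R) (W : R -> R)
    (p : point R) : point R :=
  tuple5 (T1 * p 0 it + T0)
         (T1 * p 0 ix + T1 * U0 * p 0 it + X0)
         (p 0 iu + U0)
         (p 0 iv + V0)
         (W (p 0 iw)).

(* A local diffeomorphism W is taken together with the intervals I and J it
   maps onto each other; W is injective on I since its derivative vanishes
   nowhere there. *)
Definition in_G (R : realType) (I J : set R) (phi : point R -> point R) :
    Prop :=
  exists (T0 T1 X0 U0 V0 : R) (W : R -> R),
    [/\ T1 != 0, smooth_on I W, (forall w, I w -> (W^`())%classic w != 0),
        W @` I = J & phi = transf T0 T1 X0 U0 V0 W].

(* Y = phi_* X, i.e., Y(phi(p)) = d phi_p (X(p)). *)
Definition is_pushforward (R : realType) (I : set R)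
    (phi : point R -> point R) (X Y : vfield R) : Prop :=
  forall p, dom I p -> Y (phi p) = 'D_(X p) phi p.

Definition G_equivalent (R : realType) (I : set R) (L : set (vfield R))
    (J : set R) (M : set (vfield R)) : Prop :=
  exists phi, in_G I J phi /\
    M = [set Y | exists2 X, L X & is_pushforward I phi X Y].

Definition line (R : realType) (X : vfield R) : set (vfield R) :=
  [set Y | exists c : R, Y = c *: X].

Definition restr (R : realType) (I : set R) (L : set (vfield R)) :
    set (vfield R) :=
  [set Y | exists2 X, L X & agree I X Y].

(* The listed subalgebras are defined for all w, and stand for their
   restrictions to arbitrary intervals; inequivalence is required of all these
   restrictions. *)
Definition optimal_list1 (R : realType) (Lambda : set (set (vfield R))) :
    Prop :=
  [/\ forall L, Lambda L -> one_dim_subalgebra setT L,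
      forall L M, Lambda L -> Lambda M -> L <> M ->
        forall I J, open_interval I -> open_interval J ->
          ~ G_equivalent I (restr I L) J (restr J M)
    & forall I L, open_interval I -> one_dim_subalgebra I L ->
        exists M J, [/\ Lambda M, open_interval J &
          G_equivalent I L J (restr J M)]].

(* Main.v *)
(* A transformation of G sends an element with coefficients (d, g, a, b, c) and
   parameter function Omega to one with the same d, g and c, while
     a' = T1 a - d T0,   b' = T1 (b + U0 a) - d X0 - g T0,
   and its parameter function becomes W' Omega.  Up to a scalar factor s, the
   shifts T0, X0, U0 and the scaling T1 therefore bring the coefficients to a
   unique normal form, read off from the first nonzero one among d, g, a, b, c.
   A nonvanishing Omega becomes 1 by taking for W a primitive of 1/(s Omega). *)
Require Import Defs.
From mathcomp Require Import all_boot all_order all_algebra.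
From mathcomp Require Import all_classical all_reals all_analysis.
From mathcomp Require Import ring lra.

Import Order.TTheory GRing.Theory Num.Theory.
Import numFieldNormedType.Exports.

Local Open Scope classical_set_scope.
Local Open Scope ring_scope.

Set Implicit Arguments.
Unset Strict Implicit.
Unset Printing Implicit Defensive.

(** * Differentiability to finite order and its algebra *)

(** Derivatives of products and inverses involve the functions themselves, so closure of smoothness
    is proved by induction on a finite order. Order [n] means that the [n]-th derivative is still
    derivable, that is, [n + 1] derivatives exist. *)
Definition Ck_on (R : realType) (I : set R) (n : nat) (f : R -> R) : Prop :=
  forall k w, (k <= n)%N -> I w -> derivable (f^`(k))%classic w 1.

(** Openness turns equality on [I] into equality near each of its points, which is all that a
    derivative sees. Formulas valid only on [I] can then be differentiated further. *)
Lemma derive1n_eq_on (R : realType) (I : set R) (f g : R -> R) (n : nat) :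
  open I -> {in I, f =1 g} -> {in I, (f^`(n))%classic =1 (g^`(n))%classic}.
Proof.
move=> oI fg; elim: n => [//|n IHn] w wI.
rewrite !derive1nS !derive1E; apply: near_eq_derive.
have := open_in_nearW oI IHn; exact.
Qed.

Lemma eq_Ck_on (R : realType) (I : set R) (f g : R -> R) (n : nat) :
  open I -> {in I, f =1 g} -> Ck_on I n f -> Ck_on I n g.
Proof.
move=> oI fg Cf k w kn Iw.
apply: near_eq_derivable (Cf k w kn Iw).
apply: (open_in_nearW oI (derive1n_eq_on k oI fg)).
exact/mem_set.
Qed.

Lemma Ck_onS (R : realType) (I : set R) (f : R -> R) (n : nat) :
  Ck_on I n.+1 f <->
  (forall w, I w -> derivable f w 1) /\ Ck_on I n (f^`())%classic.
Proof.
split=> [Cf|[df Cf] [|k] w kn Iw]; last 2 first.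
- exact: df.
- by rewrite derive1Sn; exact: Cf.
by split=> [w Iw|k w kn Iw]; [exact: (Cf 0%N)|rewrite -derive1Sn; exact: Cf].
Qed.

Lemma Ck_onW (R : realType) (I : set R) (f : R -> R) (n : nat) :
  Ck_on I n.+1 f -> Ck_on I n f.
Proof. by move=> Cf k w kn; apply: Cf; exact: leqW. Qed.

Lemma Ck_onD (R : realType) (I : set R) (f g : R -> R) (n : nat) :
  open I -> Ck_on I n f -> Ck_on I n g -> Ck_on I n (f + g).
Proof.
move=> oI; elim: n f g => [|n IHn] f g Cf Cg.
  move=> [|//] w _ Iw; apply: derivableD.
    exact: (Cf 0%N).
  exact: (Cg 0%N).
move/Ck_onS: Cf => [df Cf]; move/Ck_onS: Cg => [dg Cg].
apply/Ck_onS; split=> [w Iw|]; first by apply: derivableD; auto.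
apply: eq_Ck_on (IHn _ _ Cf Cg) => // w /set_mem Iw.
by rewrite derive1E deriveD -?derive1E; [|exact: df|exact: dg].
Qed.

(** Leibniz rule: in f g' + g f' the factors [f] and [g] are used one order lower, which is the
    order their derivatives have. *)
Lemma Ck_onM (R : realType) (I : set R) (f g : R -> R) (n : nat) :
  open I -> Ck_on I n f -> Ck_on I n g -> Ck_on I n (f * g).
Proof.
move=> oI; elim: n f g => [|n IHn] f g Cf Cg.
  move=> [|//] w _ Iw; apply: derivableM.
    exact: (Cf 0%N).
  exact: (Cg 0%N).
have [/Ck_onW Cf0 /Ck_onW Cg0] := (Cf, Cg).
move/Ck_onS: Cf => [df Cf]; move/Ck_onS: Cg => [dg Cg].
apply/Ck_onS; split=> [w Iw|]; first by apply: derivableM; auto.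
apply: eq_Ck_on (Ck_onD oI (IHn _ _ Cf0 Cg) (IHn _ _ Cg0 Cf)) => // w /set_mem Iw.
by rewrite derive1E deriveM -?derive1E; [|exact: df|exact: dg].
Qed.

Lemma Ck_onN (R : realType) (I : set R) (f : R -> R) (n : nat) :
  open I -> Ck_on I n f -> Ck_on I n (- f).
Proof.
move=> oI; elim: n f => [|n IHn] f Cf.
  move=> [|//] w _ Iw; apply: derivableN.
  exact: (Cf 0%N).
move/Ck_onS: Cf => [df Cf].
apply/Ck_onS; split=> [w Iw|]; first by apply: derivableN; auto.
apply: eq_Ck_on (IHn _ Cf) => // w /set_mem Iw.
by rewrite derive1E deriveN -?derive1E; [|exact: df].
Qed.

(** The derivative of 1/f is -(1/f)(1/f)f', and the induction hypothesis provides 1/f at one order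
    less. *)
Lemma Ck_onV (R : realType) (I : set R) (f : R -> R) (n : nat) :
  open I -> (forall w, I w -> f w != 0) -> Ck_on I n f ->
  Ck_on I n (fun w => (f w)^-1).
Proof.
move=> oI f0; elim: n => [|n IHn] Cf.
  by move=> [|//] w _ Iw; apply: derivableV; [exact: f0|exact: (Cf 0%N)].
have /IHn CV := Ck_onW Cf.
move/Ck_onS: Cf => [df Cf].
apply/Ck_onS; split=> [w Iw|]; first by apply: derivableV; auto.
apply: eq_Ck_on (Ck_onN oI (Ck_onM oI (Ck_onM oI CV CV) Cf)) => // w /set_mem Iw.
rewrite derive1E deriveV; [|exact: f0|exact: df].
rewrite -[LHS]/(- ((f w)^-1 * (f w)^-1 * (f^`())%classic w)) derive1E.
by rewrite -[_ *: _]/(_ * _) mulNr -exprVn expr2.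
Qed.

Lemma smooth_onV (R : realType) (I : set R) (f : R -> R) :
  open I -> (forall w, I w -> f w != 0) -> smooth_on I f ->
  smooth_on I (fun w => (f w)^-1).
Proof.
move=> oI f0 sf n w Iw; have Cf : Ck_on I n f by move=> k v _; exact: sf.
exact: (Ck_onV oI f0 Cf).
Qed.

(** * Antiderivatives and images on open intervals *)

Lemma itv_sub_is_interval (R : realType) (I : set R) (a b : R) :
  is_interval I -> I a -> I b -> `[a, b] `<=` I.
Proof. by move=> iI Ia Ib z /=; rewrite in_itv/=; exact: iI. Qed.

(** Within [I] the smaller point is moved to the left and the larger one to the right. This gives a
    compact segment with both points in its interior. *)
Lemma open_interval_surround (R : realType) (I : set R) (c w : R) :
  open_interval I -> I c -> I w ->
  exists a b, [/\ I a, I b, a < c < b & a < w < b].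
Proof.
move=> [oI iI _].
have near_in z : I z -> exists2 e, 0 < e & (I (z - e) /\ I (z + e)).
  move=> Iz; have /nbhs_ballP[e /= e0 zI] : nbhs z I by exact: open_nbhs_nbhs.
  exists (e / 2); first by rewrite divr_gt0.
  split; apply: zI; rewrite /ball/=.
    by rewrite opprB addrC subrK gtr0_norm; lra.
  by rewrite opprD addNKr normrN gtr0_norm; lra.
move=> /near_in[e e0 [Ice Ice']] /near_in[d d0 [Iwd Iwd']].
have [cw|wc] := leP c w.
  by exists (c - e), (w + d); split=> //; apply/andP; split; lra.
by exists (w - d), (c + e); split=> //; apply/andP; split; lra.
Qed.

Local Notation mu := lebesgue_measure.

(** The witness is the oriented integral of [g] from [c] to [w], written as a difference so that it
    covers both orders of the two points. *)
Lemma antiderivative_on (R : realType) (I : set R) (g : R -> R) :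
  open_interval I -> (forall w, I w -> {for w, continuous g}) ->
  exists W : R -> R, forall w, I w -> is_derive w 1 W (g w).
Proof.
move=> oiI cg; have [oI iI [c Ic]] := oiI.
exists (fun w => (\int[mu]_(t in `[c, w]) g t - \int[mu]_(t in `[w, c]) g t)%R).
move=> w Iw; have [a [b [Ia Ib /andP[ac cb] /andP[aw wb]]]] :=
  open_interval_surround oiI Ic Iw.
have abI := itv_sub_is_interval iI Ia Ib.
have intg x y : a <= x -> y <= b -> mu.-integrable `[x, y] (EFin \o g).
  move=> ax yb; apply: continuous_compact_integrable; first exact: segment_compact.
  apply: continuous_in_subspaceT => z /set_mem /=; rewrite in_itv/= => /andP[xz zy].
  apply: cg; apply: abI; rewrite /= in_itv/=; apply/andP; split; lra.
(* Integrating from [a], to the left of both [c] and [w], avoids orientation in the fundamental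
   theorem. *)
have [dF F'] := continuous_FTC1_closed wb (intg _ _ (lexx a) (lexx b)) aw (cg _ Iw).
set F := fun y => _ in dF F'.
(* Near [w] the oriented integral differs from [F] by the constant [F c]. *)
apply: (@near_eq_is_derive _ _ _ (F - cst (F c))).
  near=> y.
  have /andP[ay yb] : a < y < b.
    near: y; apply: (@open_in_nearW _ (fun y => a < y < b) `]a, b[).
    - exact: interval_open.
    - by move=> z /set_mem /=; rewrite in_itv.
    - by apply/mem_set; rewrite /= in_itv/= aw wb.
  rewrite -[LHS]/(F y - F c) /F.
  have [cy|yc] := leP c y.
    rewrite Rintegral_itvB ?bnd_simp ?(ltW ac)//; last exact: (intg _ _ _ (ltW yb)).
    rewrite Rintegral_itv_obnd_cbnd; last first.
      apply: integrableS (intg _ _ (ltW ac) (ltW yb)) => //.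
      by apply: subset_itvr; rewrite bnd_simp.
    (* For c <= y the segment [y, c] is a point or empty. *)
    rewrite [X in _ = _ - X](_ : _ = 0) ?subr0//.
    move: cy; rewrite le_eqVlt => /predU1P[<-|cy].
      by rewrite set_itv1 Rintegral_set1.
    by rewrite set_itv_ge ?Rintegral_set0// bnd_simp -ltNge.
  rewrite -opprB Rintegral_itvB ?bnd_simp ?(ltW ay) ?(ltW yc)//; last first.
    exact: (intg _ _ _ (ltW cb)).
  rewrite Rintegral_itv_obnd_cbnd; last first.
    apply: integrableS (intg _ _ (ltW ay) (ltW cb)) => //.
    by apply: subset_itvr; rewrite bnd_simp.
  by rewrite [`[c, y]%classic]set_itv_ge ?Rintegral_set0 ?sub0r// bnd_simp -ltNge.
move: F dF F' => F dF F'; rewrite -F' derive1E -[X in is_derive _ _ _ X]subr0.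
exact: is_deriveB (DeriveDef dF erefl) (is_derive_cst _ _ _).
Unshelve. all: by end_near. Qed.

(** The intermediate value theorem makes the image an interval. It is open because a nonzero
    derivative excludes extrema, so [W] takes values on both sides of each [W w]. *)
Lemma image_open_interval (R : realType) (I : set R) (W : R -> R) :
  open_interval I -> (forall w, I w -> derivable W w 1) ->
  (forall w, I w -> (W^`())%classic w != 0) -> open_interval (W @` I).
Proof.
move=> oiI dW W'0; have [oI iI [c Ic]] := oiI.
have cW a b : I a -> I b -> {within `[a, b], continuous W}.
  move=> Ia Ib; apply: continuous_in_subspaceT => z /set_mem /=.
  move=> /(itv_sub_is_interval iI Ia Ib) Iz.
  exact/differentiable_continuous/derivable1_diffP/dW.
have ivt a b v : I a -> I b -> W a <= v <= W b -> (W @` I) v.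
  have [ab|ba] := leP a b => Ia Ib /andP[av vb].
    have [|z zab <-] := IVT ab (cW _ _ Ia Ib) (v := v).
      by rewrite ge_min le_max av vb orbT.
    by exists z => //; exact: (itv_sub_is_interval iI Ia Ib).
  have [|z zab <-] := IVT (ltW ba) (cW _ _ Ib Ia) (v := v).
    by rewrite ge_min le_max av vb orbT.
  by exists z => //; exact: (itv_sub_is_interval iI Ib Ia).
split; last by exists (W c), c.
  rewrite openE => _ [w Iw <-].
  have [a [b [Ia Ib _ /andP[aw wb]]]] := open_interval_surround oiI Iw Iw.
  have abI t : t \in `]a, b[ -> I t.
    by move=> /subset_itv_oo_cc; exact: (itv_sub_is_interval iI Ia Ib).
  have wab : w \in `]a, b[ by rewrite in_itv/= aw.
  have dab t : t \in `]a, b[ -> derivable W t 1 by move=> /abI; exact: dW.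
  (* Since W' w != 0, w is not an extremum of W on ]a, b[. *)
  have W'w := W'0 _ Iw; rewrite derive1E in W'w.
  have [a1 Ia1 Waw] : exists2 a1, I a1 & W a1 < W w.
    apply: contrapT => noa; move: W'w.
    suff [_ ->] : is_derive w 1 W 0 by rewrite eqxx.
    apply: (derive1_at_min _ dab wab); first by rewrite ltW// (lt_trans aw).
    by move=> t /abI It; rewrite leNgt; apply/negP => tw; apply: noa; exists t.
  have [b1 Ib1 Wwb] : exists2 b1, I b1 & W w < W b1.
    apply: contrapT => nob; move: W'w.
    suff [_ ->] : is_derive w 1 W 0 by rewrite eqxx.
    apply: (derive1_at_max _ dab wab); first by rewrite ltW// (lt_trans aw).
    by move=> t /abI It; rewrite leNgt; apply/negP => tw; apply: nob; exists t.
  apply: (filterS (P := `]W a1, W b1[)).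
    move=> v /=; rewrite in_itv/= => /andP[av vb].
    by apply: (ivt a1 b1) => //; rewrite !ltW.
  apply: open_nbhs_nbhs; split; first exact: interval_open.
  by rewrite /= in_itv/= Waw Wwb.
by move=> _ _ [a Ia <-] [b Ib <-] z; exact: ivt.
Qed.

(** * Coordinates and directional derivatives in the five variables *)

Lemma tuple5E (R : realType) (t x u v w : R) :
  (tuple5 t x u v w 0 it = t) * (tuple5 t x u v w 0 ix = x) *
  (tuple5 t x u v w 0 iu = u) * (tuple5 t x u v w 0 iv = v) *
  (tuple5 t x u v w 0 iw = w).
Proof. by rewrite !mxE. Qed.

Lemma ord5_cases (P : 'I_5 -> Prop) :
  P it -> P ix -> P iu -> P iv -> P iw -> forall i, P i.
Proof.
move=> Pt Px Pu Pv Pw i.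
have : [|| i == it, i == ix, i == iu, i == iv | i == iw].
  by case: i => [[|[|[|[|[|]]]]]].
by case/or4P => [/eqP->|/eqP->|/eqP->|/orP[/eqP->|/eqP->]].
Qed.

Lemma point_eqP (R : realType) (p q : 'rV[R]_5) :
  p 0 it = q 0 it -> p 0 ix = q 0 ix -> p 0 iu = q 0 iu -> p 0 iv = q 0 iv ->
  p 0 iw = q 0 iw -> p = q.
Proof.
by move=> ? ? ? ? ?; apply/rowP; exact: ord5_cases.
Qed.

Definition vf (R : realType) (d g a b c : R) (Omega : R -> R) : vfield R :=
  d *: vD R + g *: vG R + a *: vPt R + b *: vPx R + c *: vPv R + vW Omega.

Lemma vfE (R : realType) (d g a b c : R) (Omega : R -> R) (p : 'rV[R]_5) :
  vf d g a b c Omega p =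
  tuple5 (d * p 0 it + a) (d * p 0 ix + g * p 0 it + b) g c (Omega (p 0 iw)).
Proof.
by apply: point_eqP; rewrite !tuple5E !mxE/=; ring.
Qed.

Lemma is_derive_coord (R : realType) (p v : 'rV[R]_5) (i : 'I_5) :
  is_derive p v (fun q : 'rV[R]_5 => q 0 i) (v 0 i).
Proof.
apply: DeriveDef; first exact/diff_derivable/differentiable_coord.
have /matrixP/(_ 0 i) := derive_mx (@derivable_id _ _ p v).
by rewrite mxE derive_id.
Qed.

Lemma is_derive_coord_comp (R : realType) (W : R -> R) (p v : 'rV[R]_5)
    (i : 'I_5) :
  derivable W (p 0 i) 1 ->
  is_derive p v (fun q : 'rV[R]_5 => W (q 0 i))
    (v 0 i * (W^`())%classic (p 0 i)).
Proof.
move=> dW; have dp : differentiable (fun q : 'rV[R]_5 => q 0 i : R) p.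
  exact: differentiable_coord.
have dWp : differentiable W (p 0 i) by exact/derivable1_diffP.
have dc : differentiable (W \o (fun q : 'rV[R]_5 => q 0 i : R)) p.
  exact: differentiable_comp.
apply: DeriveDef; first exact: diff_derivable.
rewrite deriveE// diff_comp//= derive1E deriveE//.
have [_ <-] := is_derive_coord p v i; rewrite deriveE//.
(* The increment is written as itself times 1, and linearity of the differential pulls it out. *)
by rewrite -[X in 'd W (p 0 i) X = _]mulr1
  -[X in 'd W (p 0 i) X = _]/(_ *: _) linearZ.
Qed.

Lemma derive_tuple5 (R : realType) (p y : 'rV[R]_5) (t x u v w : 'rV[R]_5 -> R)
    (dt dx du dv dw : R) :
  is_derive p y t dt -> is_derive p y x dx -> is_derive p y u du ->
  is_derive p y v dv -> is_derive p y w dw ->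
  'D_y (fun q => tuple5 (t q) (x q) (u q) (v q) (w q)) p = tuple5 dt dx du dv dw.
Proof.
move=> [tp <-] [xp <-] [up <-] [vp <-] [wp <-].
set T := fun q => _.
have [Tt Tx Tu Tv Tw] : [/\ (fun q => T q 0 it) = t, (fun q => T q 0 ix) = x,
    (fun q => T q 0 iu) = u, (fun q => T q 0 iv) = v & (fun q => T q 0 iw) = w].
  by split; apply/funext => q; rewrite /T tuple5E.
clearbody T.
rewrite derive_mx.
  by apply: point_eqP; rewrite mxE tuple5E ?(Tt, Tx, Tu, Tv, Tw).
apply/derivable_mxP => i; rewrite ord1.
apply: ord5_cases.
- by rewrite Tt; exact: tp.
- by rewrite Tx; exact: xp.
- by rewrite Tu; exact: up.
- by rewrite Tv; exact: vp.
- by rewrite Tw; exact: wp.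
Qed.

(** Serves to compute brackets; a constant parameter function contributes nothing to the last
    component. *)
Lemma derive_vf (R : realType) (d g a b c e : R) (p y : 'rV[R]_5) :
  'D_y (vf d g a b c (cst e)) p =
  tuple5 (d * y 0 it) (d * y 0 ix + g * y 0 it) 0 0 0.
Proof.
rewrite (funext (@vfE R d g a b c (cst e))).
have ct i := is_derive_coord p y i.
apply: derive_tuple5.
- by apply: is_derive_eq; rewrite addr0 -[_ *: _]/(_ * _).
- by apply: is_derive_eq; rewrite addr0.
- exact: is_derive_cst.
Qed.

Lemma derive_transf (R : realType) (T0 T1 X0 U0 V0 : R) (W : R -> R)
    (p y : 'rV[R]_5) :
  derivable W (p 0 iw) 1 ->
  'D_y (transf T0 T1 X0 U0 V0 W) p =
  tuple5 (T1 * y 0 it) (T1 * y 0 ix + T1 * U0 * y 0 it) (y 0 iu) (y 0 iv)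
         (y 0 iw * (W^`())%classic (p 0 iw)).
Proof.
move=> dW; have ct i := is_derive_coord p y i.
apply: derive_tuple5.
- by apply: is_derive_eq; rewrite addr0.
- by apply: is_derive_eq; rewrite addr0.
- by apply: is_derive_eq; rewrite addr0.
- by apply: is_derive_eq; rewrite addr0.
- exact: is_derive_coord_comp.
Qed.

(** * Normal forms of the coefficients *)

Definition bit (R : realType) (x : R) : Prop := x = 0 \/ x = 1.

(** The six cases follow the order of the six listed families, with [e] in the role of delta_1. The
    unconstrained [g] and [c] of the first case and [c] of the second are the free parameters of the
    list. *)
Definition normal_form (R : realType) (d g a b c e : R) : Prop :=
  [/\ d = 1, a = 0, b = 0 & bit e] \/
  [/\ d = 0, g = 1, bit a, b = 0 & bit e] \/
  [/\ d = 0 /\ g = 0, a = 1, b = 0, bit c & bit e] \/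
  [/\ d = 0 /\ g = 0, a = 0, b = 1, bit c & bit e] \/
  [/\ d = 0 /\ g = 0, a = 0, b = 0, c = 1 & bit e] \/
  [/\ d = 0 /\ g = 0, a = 0, b = 0, c = 0 & e = 1].

(* [transf] maps s times the element with coefficients d, g, a, b, c to the one
   with coefficients d', g', a', b', c'; the parameter functions are left out. *)
Definition coef_action (R : realType)
    (s T0 T1 X0 U0 d g a b c d' g' a' b' c' : R) : Prop :=
  [/\ d' = s * d, g' = s * g, a' + d' * T0 = s * T1 * a,
      b' + d' * X0 + g' * T0 = s * T1 * (b + U0 * a) & c' = s * c].

(** For fixed [w] both sides are affine in [t] and [x], so their equality is a comparison of
    coefficients. Working over a single [w] suffices for inequivalence, and letting [w] vary gives
    equivalence. *)
Lemma vf_transfP (R : realType) (s T0 T1 X0 U0 V0 : R) (W : R -> R)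
    (d g a b c d' g' a' b' c' : R) (Omega Omega' : R -> R) (w : R) :
  T1 != 0 -> derivable W w 1 ->
  (forall p : 'rV[R]_5, p 0 iw = w ->
     vf d' g' a' b' c' Omega' (transf T0 T1 X0 U0 V0 W p) =
     'D_(s *: vf d g a b c Omega p) (transf T0 T1 X0 U0 V0 W) p) <->
  coef_action s T0 T1 X0 U0 d g a b c d' g' a' b' c' /\
  Omega' (W w) = s * Omega w * (W^`())%classic w.
Proof.
move=> T10 dW; split=> [E|[[d'E g'E a'E b'E c'E] wE] p pw].
  have {E} E t x : let p := tuple5 t x 0 0 w in
     vf d' g' a' b' c' Omega' (transf T0 T1 X0 U0 V0 W p) =
     'D_(s *: vf d g a b c Omega p) (transf T0 T1 X0 U0 V0 W) p.
    by apply: E; rewrite tuple5E.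
  have {}E t x : tuple5 (d' * (T1 * t + T0) + a')
     (d' * (T1 * x + T1 * U0 * t + X0) + g' * (T1 * t + T0) + b') g' c'
     (Omega' (W w)) =
     tuple5 (T1 * (s * (d * t + a)))
      (T1 * (s * (d * x + g * t + b)) + T1 * U0 * (s * (d * t + a)))
      (s * g) (s * c) (s * Omega w * (W^`())%classic w).
    have := E t x; rewrite /= derive_transf ?tuple5E// !vfE.
    by rewrite ![(s *: tuple5 _ _ _ _ _) _ _]mxE /transf !tuple5E mulrC.
  have Et t : d' * (T1 * t + T0) + a' = T1 * (s * (d * t + a)).
    by have /rowP/(_ it) := E t 0; rewrite !tuple5E.
  have Ex : d' * (T1 * 0 + T1 * U0 * 0 + X0) + g' * (T1 * 0 + T0) + b' =
      T1 * (s * (d * 0 + g * 0 + b)) + T1 * U0 * (s * (d * 0 + a)).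
    by have /rowP/(_ ix) := E 0 0; rewrite !tuple5E.
  (* Subtracting the values at t = 0 and t = 1 leaves the slopes, multiplied by [T1]. *)
  have d'E : d' = s * d by apply: (mulfI T10); have := Et 0; have := Et 1; lra.
  split; last by have /rowP/(_ iw) := E 0 0; rewrite !tuple5E.
  split=> //.
  - by have /rowP/(_ iu) := E 0 0; rewrite !tuple5E.
  - by have := Et 0; lra.
  - by lra.
  - by have /rowP/(_ iv) := E 0 0; rewrite !tuple5E.
rewrite derive_transf ?pw// !vfE.
rewrite ![(s *: tuple5 _ _ _ _ _) _ _]mxE /transf !tuple5E pw wE.
rewrite (_ : a' = s * T1 * a - d' * T0); last by rewrite -a'E addrK.
rewrite (_ : b' = s * T1 * (b + U0 * a) - d' * X0 - g' * T0); last first.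
  by rewrite -b'E; ring.
by rewrite c'E d'E g'E; congr tuple5; ring.
Qed.

Lemma bit_inj (R : realType) (x y : R) :
  bit x -> bit y -> (y = 0 <-> x = 0) -> y = x.
Proof.
move=> [->|->] [->|->] // [h k]; first by rewrite k.
by rewrite h.
Qed.

Lemma normal_form_bit (R : realType) (d g a b c e : R) :
  normal_form d g a b c e -> bit e.
Proof.
by case=> [[]|[[]|[[]|[[]|[[]|[_ _ _ _ ->]]]]]] //; right.
Qed.

(** The action preserves the position of the first nonzero coefficient, hence the family. Within a
    family, [s] is forced to be 1 in the first two cases, and the remaining 0/1 coefficients are
    proportional by a nonzero factor. *)
Lemma normal_form_inj (R : realType)
    (s T0 T1 X0 U0 d g a b c e d' g' a' b' c' e' : R) :
  T1 != 0 -> (e' = 0 <-> s * e = 0) ->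
  coef_action s T0 T1 X0 U0 d g a b c d' g' a' b' c' ->
  normal_form d g a b c e -> normal_form d' g' a' b' c' e' ->
  [/\ d' = d, g' = g, a' = a, b' = b & c' = c] /\ e' = e.
Proof.
move=> T10 e'E [d'E g'E a'E b'E c'E] nf nf'.
(* For s = 0 the image would be the zero element, which is no normal form. *)
have s0 : s != 0.
  apply/eqP => s0; rewrite s0 !mul0r in d'E g'E a'E b'E c'E e'E.
  have e'0 : e' = 0 by exact/e'E.
  rewrite d'E g'E !mul0r ?addr0 in a'E b'E.
  by case: nf' => [[]|[[]|[[]|[[]|[[]|[]]]]]]; lra.
have eE : e' = e.
  apply: bit_inj (normal_form_bit nf) (normal_form_bit nf') _.
  by rewrite e'E; split=> [/eqP|->]; rewrite ?mulr0// mulf_eq0 (negbTE s0) => /eqP.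
split=> //; move: nf'; rewrite {}eE {e'E e'} => nf'.
have sT0 : s * T1 != 0 by rewrite mulf_neq0.
have bitZ (m x y : R) : m != 0 -> bit x -> bit y -> y = m * x -> y = x.
  move=> m0 bx bY yE; apply: bit_inj => //; rewrite yE.
  by split=> [/eqP|->]; rewrite ?mulr0// mulf_eq0 (negbTE m0) => /eqP.
move/eqP in s0; move/eqP in sT0.
case: nf => [[d1 a1 b1 _]|[[d1 g1 a1 b1 _]|[[[d1 g1] a1 b1 c1 _]|
  [[[d1 g1] a1 b1 c1 _]|[[[d1 g1] a1 b1 c1 _]|[[d1 g1] a1 b1 c1 _]]]]]];
case: nf' => [[d2 a2 b2 _]|[[d2 g2 a2 b2 _]|[[[d2 g2] a2 b2 c2 _]|
  [[[d2 g2] a2 b2 c2 _]|[[[d2 g2] a2 b2 c2 _]|[[d2 g2] a2 b2 c2 _]]]]]];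
try rewrite a1 in a'E b'E; try rewrite b1 in b'E; try rewrite c1 in c'E;
rewrite d1 in d'E; try rewrite g1 in g'E; rewrite d2 in d'E a'E b'E;
try rewrite g2 in g'E b'E;
(* Pairs from different families either contradict each other or force [s] or [s * T1] to vanish.
   The six diagonal pairs remain. *)
try (exfalso; first [lra | by apply: s0; lra | by apply: sT0; lra]).
- have s1 : s = 1 by lra.
  by split; rewrite ?g'E ?c'E ?s1 ?mul1r//; lra.
- have s1 : s = 1 by lra.
  split; rewrite ?c'E ?s1 ?mul1r//; try lra.
  by apply: (bitZ (s * T1)) => //; [exact/eqP|lra].
- split; try lra.
  by apply: (bitZ s) => //; exact/eqP.
- split; try lra.
  by apply: (bitZ s) => //; exact/eqP.
- by split; lra.
- by split; lra.
Qed.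

Lemma normal_form_exists (R : realType) (d g a b c e : R) :
  bit e -> ~ [/\ d = 0 /\ g = 0, a = 0, b = 0, c = 0 & e = 0] ->
  exists s T0 T1 X0 U0 d' g' a' b' c',
    [/\ s != 0, T1 != 0, normal_form d' g' a' b' c' e &
        coef_action s T0 T1 X0 U0 d g a b c d' g' a' b' c'].
Proof.
move=> be nz.
have [d0|d0] := eqVneq d 0; last first.
  (* The factor [s] makes the coefficient of D equal to 1; then [T0] cancels [a] and [X0] cancels
     [b]. *)
  exists d^-1, (d^-1 * a), 1, (d^-1 * b - d^-1 * g * (d^-1 * a)), 0.
  exists 1, (d^-1 * g), 0, 0, (d^-1 * c).
  split; rewrite ?invr_eq0 ?oner_neq0//; first by left.
  by split=> //; [rewrite mulVf|ring|ring].
have [g0|g0] := eqVneq g 0; last first.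
  (* Here [s] is used up on [g], so a nonzero [a] is scaled to 1 by [T1]; [T0] cancels [b]. *)
  pose T1 := if a == 0 then 1 else g / a.
  exists g^-1, (g^-1 * T1 * b), T1, 0, 0.
  exists 0, 1, (g^-1 * T1 * a), 0, (g^-1 * c).
  split; rewrite ?invr_eq0//.
  - by rewrite /T1; case: (eqVneq a 0) => a0; rewrite ?oner_neq0// mulf_neq0 ?invr_eq0.
  - right; left; split=> //; rewrite /T1; case: (eqVneq a 0) => a0; [left|right].
      by rewrite a0 mulr0.
    by field; rewrite ?a0 ?g0.
  - by split=> //; rewrite ?d0 ?mulr0 ?mulVf//; ring.
(* With d = g = 0 the factor [s] is free to normalize [c], while [T1] normalizes [a] or [b]. If [a]
   is nonzero, U0 = -b/a removes [b]. *)
pose s := if c == 0 then 1 else c^-1.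
have s0 : s != 0 by rewrite /s; case: (eqVneq c 0) => c0; rewrite ?oner_neq0 ?invr_eq0.
have bs : bit (s * c).
  by rewrite /s; case: (eqVneq c 0) => c0; [left; rewrite c0 mulr0|right; rewrite mulVf].
have [a0|a0] := eqVneq a 0; last first.
  exists s, 0, (s^-1 / a), 0, (- b / a), 0, 0, 1, 0, (s * c).
  split; rewrite ?(mulf_eq0, negb_or, invr_eq0) ?s0//; first by right; right; left.
  by split; rewrite ?d0 ?g0 ?mulr0//; field; rewrite ?s0 ?a0.
have [b0|b0] := eqVneq b 0; last first.
  exists s, 0, (s^-1 / b), 0, 0, 0, 0, 0, 1, (s * c).
  split; rewrite ?(mulf_eq0, negb_or, invr_eq0) ?s0//; first by right; right; right; left.
  by split; rewrite ?d0 ?g0 ?a0 ?mulr0//; field; rewrite ?s0 ?b0.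
exists s, 0, 1, 0, 0, 0, 0, 0, 0, (s * c).
split; rewrite ?oner_neq0//; last first.
  by split; rewrite ?d0 ?g0 ?a0 ?b0 ?mulr0//; ring.
(* Only [c] and [e] are left; if c = 0, then e = 1 since the element is nonzero. *)
do 4!right; rewrite /s; have [c0|c0] := eqVneq c 0; [right|left].
  split=> //; first by rewrite c0 mulr0.
  by case: be => // e0; case: nz.
by split=> //; rewrite mulVf.
Qed.

(** * Smoothness of constants and antiderivatives *)

Lemma smooth_on_cst (R : realType) (I : set R) (e : R) : smooth_on I (cst e).
Proof.
move=> n w _; suff [r ->] : exists r : R, ((cst e : R -> R)^`(n))%classic = cst r.
  exact: derivable_cst.
elim: n => [|n [r IHn]]; first by exists e.
by exists 0; rewrite derive1nS IHn; apply/funext => z; rewrite derive1_cst.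
Qed.

Lemma smooth_on_antiderivative (R : realType) (I : set R) (W g : R -> R) :
  open I -> (forall w, I w -> is_derive w 1 W (g w)) -> smooth_on I g ->
  smooth_on I W.
Proof.
move=> oI Wg sg [|n] w Iw; first by have [] := Wg w Iw.
rewrite derive1Sn; apply: (eq_Ck_on oI _ _ (leqnn n) Iw); last first.
  by move=> k v _; exact: sg.
by move=> v /set_mem Iv; have [_ <-] := Wg v Iv; rewrite derive1E.
Qed.

(** * Lines spanned by normal forms, and their inequivalence *)

Lemma scale_vf (R : realType) (k d g a b c e : R) :
  k *: vf d g a b c (cst e) =
  vf (k * d) (k * g) (k * a) (k * b) (k * c) (cst (k * e)).
Proof.
apply/funext => p; rewrite -[LHS]/(k *: vf d g a b c (cst e) p) !vfE.
by apply: point_eqP; rewrite mxE !tuple5E//; ring.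
Qed.

(** Linear independence of the generators, tested at x = u = v = 0 with t = 0 and t = 1. *)
Lemma vf_agree0 (R : realType) (I : set R) (d g a b c w : R) (Omega : R -> R) :
  agree I (vf d g a b c Omega) 0 -> I w ->
  [/\ d = 0 /\ g = 0, a = 0, b = 0, c = 0 & Omega w = 0].
Proof.
move=> X0 Iw.
have {}X0 t : tuple5 (d * t + a) (d * 0 + g * t + b) g c (Omega w) = 0.
  have := X0 (tuple5 t 0 0 0 w); rewrite /dom/= vfE !tuple5E => /(_ Iw) ->.
  by [].
have E t i := congr1 (fun v : 'rV[R]_5 => v 0 i) (X0 t).
have := E 1 it; have := E 0 it; have := E 0 ix; have := E 0 iu.
have := E 0 iv; have := E 0 iw; rewrite !tuple5E !mxE => *.
by do !split; lra.
Qed.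

Lemma normal_form_neq0 (R : realType) (I : set R) (d g a b c e : R) :
  normal_form d g a b c e -> I !=set0 -> ~ agree I (vf d g a b c (cst e)) 0.
Proof.
move=> nf [w Iw] /vf_agree0/(_ Iw)[[d0 g0] a0 b0 c0 e0]; rewrite /cst in e0.
by case: nf => [[]|[[]|[[]|[[]|[[]|[]]]]]]; lra.
Qed.

Lemma one_dim_line (R : realType) (d g a b c e : R) :
  normal_form d g a b c e ->
  one_dim_subalgebra setT (line (vf d g a b c (cst e))).
Proof.
move=> nf; have eqT (X Y : vfield R) : agree setT X Y -> X = Y.
  by move=> XY; apply/funext => p; exact: XY.
split.
- split.
  + move=> _ [k ->]; rewrite scale_vf.
    by do 6!eexists; split; [exact: (@smooth_on_cst _ _ (k * e))|move=> p _].
  + by move=> X Y /eqT <-.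
  + by exists 0; rewrite scale0r.
  + by move=> _ _ [k ->] [l ->]; exists (k + l); rewrite scalerDl.
  + by move=> k _ [l ->]; exists (k * l); rewrite scalerA.
  (* Multiples of one field commute. *)
  + move=> _ _ [k ->] [l ->]; exists 0; rewrite scale0r; apply/funext => p.
    rewrite /bracket !scale_vf !derive_vf !vfE !tuple5E.
    by apply: point_eqP; rewrite !mxE/=; ring.
- exists (vf d g a b c (cst e)); split.
  + by exists 1; rewrite scale1r.
  + by apply: normal_form_neq0 => //; exists 0.
  + by move=> _ [k ->]; exists k.
- move=> _ [k ->]; rewrite scale_vf; have [ke|ke] := eqVneq (k * e) 0.
    by left=> p _; rewrite vfE tuple5E.
  by right=> p _; rewrite vfE tuple5E.
Qed.

(** The generator of the second line is the pushforward of some multiple [s] of the first.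
    Comparison over one point [w] of [I] yields [coef_action], and uniqueness of the normal form
    applies. *)
Lemma G_equivalent_line_normal_form (R : realType) (I J : set R)
    (d g a b c e d' g' a' b' c' e' : R) :
  normal_form d g a b c e -> normal_form d' g' a' b' c' e' -> I !=set0 ->
  G_equivalent I (restr I (line (vf d g a b c (cst e))))
               J (restr J (line (vf d' g' a' b' c' (cst e')))) ->
  line (vf d g a b c (cst e)) = line (vf d' g' a' b' c' (cst e')).
Proof.
move=> nf nf' [w Iw] [phi [[T0 [T1 [X0 [U0 [V0 [W [T10 sW W'0 _ ->]]]]]]] ME]].
have : restr J (line (vf d' g' a' b' c' (cst e'))) (vf d' g' a' b' c' (cst e')).
  by exists (vf d' g' a' b' c' (cst e')) => //; exists 1; rewrite scale1r.
rewrite ME => -[X [_ [s ->] XE] pX].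
have [|act eE] := (@vf_transfP R s T0 T1 X0 U0 V0 W d g a b c d' g' a' b' c'
  (cst e) (cst e') w T10 (sW 0%N w Iw)).1.
  move=> p pw; have Ip : dom I p by rewrite /dom/= pw.
  by rewrite (pX p Ip) -(XE p Ip).
(* Since W' does not vanish at [w], the constant e' = s e W'(w) is zero exactly when s e is. *)
have e'0 : e' = 0 <-> s * e = 0.
  rewrite /cst in eE; rewrite eE; split=> [/eqP|->]; last by rewrite mul0r.
  by rewrite mulf_eq0 (negbTE (W'0 w Iw)) orbF => /eqP.
by have [[-> -> -> -> ->] ->] := normal_form_inj T10 e'0 act nf nf'.
Qed.

(** * Reduction of an arbitrary one-dimensional subalgebra *)

Lemma straighten_param (R : realType) (I : set R) (Omega : R -> R) (s e : R) :
  open_interval I -> smooth_on I Omega -> s != 0 ->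
  (forall w, I w -> Omega w = 0) /\ e = 0 \/
  (forall w, I w -> Omega w != 0) /\ e = 1 ->
  exists W : R -> R, [/\ smooth_on I W,
    forall w, I w -> (W^`())%classic w != 0 &
    forall w, I w -> e = s * Omega w * (W^`())%classic w].
Proof.
move=> oiI sO s0 Oe; have [oI _ _] := oiI.
have [h [sh h0 hE]] : exists h : R -> R, [/\ smooth_on I h,
    forall w, I w -> h w != 0 & forall w, I w -> e = s * Omega w * h w].
  case: Oe => [[ Oz ->]|[ Oz ->]].
    (* If Omega vanishes, the equation puts no condition on W', and slope 1 is chosen. *)
    exists (cst 1); split; first exact: smooth_on_cst.
    - by move=> w _; rewrite oner_neq0.
    - by move=> w /Oz ->; rewrite mulr0 mul0r.
  exists (fun w => (s * Omega w)^-1).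
  have sO0 w : I w -> s * Omega w != 0 by move=> /Oz; exact: mulf_neq0.
  split; [|by move=> w /sO0; rewrite invr_eq0|by move=> w /sO0 ?; rewrite mulfV].
  apply: (smooth_onV oI sO0) => n w Iw.
  apply: (@Ck_onM _ _ (cst s) Omega n oI _ _ n w (leqnn n) Iw).
    by move=> k v _; exact: smooth_on_cst.
  by move=> k v _; exact: sO.
have [W Wh] : exists W : R -> R, forall w, I w -> is_derive w 1 W (h w).
  apply: antiderivative_on => // w Iw.
  exact/differentiable_continuous/derivable1_diffP/(sh 0%N).
have W'E w : I w -> (W^`())%classic w = h w.
  by move=> /Wh[_ <-]; rewrite derive1E.
exists W; split; first exact: smooth_on_antiderivative Wh sh.
- by move=> w Iw; rewrite W'E// h0.
- by move=> w Iw; rewrite W'E// -hE.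
Qed.

(** A spanning field [X] is brought to normal form by combining the change of coefficients with the
    straightening of Omega. As [L] consists of the multiples of [X] on [dom I], the whole of [L] is
    carried along. *)
Lemma G_equivalent_normal_form (R : realType) (I : set R) (L : set (vfield R)) :
  open_interval I -> one_dim_subalgebra I L ->
  exists d g a b c e, normal_form d g a b c e /\
    exists2 J, open_interval J &
      G_equivalent I L J (restr J (line (vf d g a b c (cst e)))).
Proof.
move=> oiI [sL [X [LX X0 Lspan]] zL]; have [oI iI [w0 Iw0]] := oiI.
have [d [g [a [b [c [ Omega [sO XE]]]]]]] := subalgebra_sub sL LX.
rewrite -/(vf d g a b c Omega) in XE.
have XiwE p : dom I p -> X p 0 iw = Omega (p 0 iw).
  by move=> Ip; rewrite XE// vfE tuple5E.
have OmegaE w : I w -> Omega w = X (tuple5 0 0 0 0 w) 0 iw.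
  by move=> Iw; rewrite XiwE /dom/= ?tuple5E.
have [e Oe] : exists e : R, (forall w, I w -> Omega w = 0) /\ e = 0 \/
    (forall w, I w -> Omega w != 0) /\ e = 1.
  have [z|nz] := zL X LX; [exists 0; left|exists 1; right]; split=> // w Iw.
    by rewrite OmegaE// z// /dom/= tuple5E.
  by rewrite OmegaE// nz// /dom/= tuple5E.
have be : bit e by case: Oe => [[_ ->]|[_ ->]]; [left|right].
have nz : ~ [/\ d = 0 /\ g = 0, a = 0, b = 0, c = 0 & e = 0].
  move=> [[d0 g0] a0 b0 c0 e0]; apply: X0 => p Ip; rewrite XE// vfE.
  case: Oe => [[ Oz _]|[_ e1]]; last by move/eqP: e1; rewrite e0 eq_sym oner_eq0.
  by apply: point_eqP; rewrite tuple5E mxE ?d0 ?g0 ?a0 ?b0 ?c0 ?Oz//; lra.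
have [s [T0 [T1 [X0' [U0 [d' [g' [a' [b' [c' [s0 T10 nf act]]]]]]]]]]] :=
  normal_form_exists be nz.
have [W [sW W'0 We]] := straighten_param oiI sO s0 Oe.
exists d', g', a', b', c', e; split=> //; exists (W @` I).
  by apply: image_open_interval => // w Iw; exact: (sW 0%N).
pose phi := transf T0 T1 X0' U0 0 W.
set M := vf d' g' a' b' c' (cst e).
have push p : dom I p -> M (phi p) = 'D_(s *: X p) phi p.
  move=> Ip; rewrite XE//.
  have [_] := @vf_transfP R s T0 T1 X0' U0 0 W d g a b c d' g' a' b' c'
    Omega (cst e) (p 0 iw) T10 (sW 0%N _ Ip).
  by apply=> //; split=> //; exact: We.
have pushZ k p : dom I p -> k *: M (phi p) = 'D_((k * s) *: X p) phi p.
  move=> Ip; rewrite push// !derive_transf; try exact: (sW 0%N).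
  by apply: point_eqP; rewrite mxE !tuple5E ![(_ *: X p) _ _]mxE; ring.
exists phi; split; first by exists T0, T1, X0', U0, 0, W; split.
apply/seteqP; split=> Y.
  (* As [s X] goes to [M], the field [k M] comes from [k s X]. *)
  move=> [_ [k ->] YE]; exists ((k * s) *: X); first exact: (subalgebraZ sL).
  move=> p Ip; rewrite -[in RHS]pushZ// -YE//.
  by rewrite /dom/= /phi /transf tuple5E; exists (p 0 iw).
move=> [X' LX' pX']; have [k kE] := Lspan X' LX'.
(* Conversely [k X] is sent to [(k / s) M], with equality to be checked only over J = W(I). *)
exists ((k / s) *: M); first by exists (k / s).
move=> q [w Iw wE].
(* An explicit preimage of [q]: the affine part of the transformation is inverted, and [w] comes
   from the membership in W(I). *)
pose t := (q 0 it - T0) / T1.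
pose p := tuple5 t ((q 0 ix - T1 * U0 * t - X0') / T1) (q 0 iu - U0) (q 0 iv) w.
have pq : phi p = q.
  apply: point_eqP; rewrite /phi /transf !tuple5E ?wE ?addr0 ?subrK//.
    by rewrite /t; field.
  by field.
have Ip : dom I p by rewrite /dom/= tuple5E.
rewrite -pq (pX' p Ip) (kE p Ip) -[LHS]/((k / s) *: M (phi p)).
by rewrite (pushZ _ p Ip) (divfK s0).
Qed.

(** * The listed families as normal forms, and the conclusion *)

Lemma bitP (R : realType) (x : R) : bit x <-> exists d : bool, x = d%:R.
Proof.
split=> [[->|->]|[[] ->]]; [by exists false|by exists true|by right|by left].
Qed.

(** Dropping the terms with coefficient 0 matches each family with one case of [normal_form];
    booleans encode delta_1 and delta_2. *)
Lemma normal_form_lineP (R : realType) (L : set (vfield R)) :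
  ((exists (a b : R) (d1 : bool),
      L = line (vD R + a *: vG R + b *: vPv R + vW (cst d1%:R)))
   \/ (exists (b : R) (d1 d2 : bool),
      L = line (vG R + d2%:R *: vPt R + b *: vPv R + vW (cst d1%:R)))
   \/ (exists d1 d2 : bool,
      L = line (vPt R + d2%:R *: vPv R + vW (cst d1%:R)))
   \/ (exists d1 d2 : bool,
      L = line (vPx R + d2%:R *: vPv R + vW (cst d1%:R)))
   \/ (exists d1 : bool, L = line (vPv R + vW (cst d1%:R)))
   \/ L = line (vW (cst 1))) <->
  exists d g a b c e, normal_form d g a b c e /\
    L = line (vf d g a b c (cst e)).
Proof.
have bitb (d : bool) : bit (d%:R : R) by apply/bitP; exists d.
have eDE (a b e : R) :
    vD R + a *: vG R + b *: vPv R + vW (cst e) = vf 1 a 0 0 b (cst e).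
  by rewrite /vf !scale0r scale1r !addr0.
have eGE (a b e : R) :
    vG R + a *: vPt R + b *: vPv R + vW (cst e) = vf 0 1 a 0 b (cst e).
  by rewrite /vf !scale0r scale1r !(addr0, add0r).
have ePtE (c e : R) : vPt R + c *: vPv R + vW (cst e) = vf 0 0 1 0 c (cst e).
  by rewrite /vf !scale0r scale1r !(addr0, add0r).
have ePxE (c e : R) : vPx R + c *: vPv R + vW (cst e) = vf 0 0 0 1 c (cst e).
  by rewrite /vf !scale0r scale1r !(addr0, add0r).
have ePvE (e : R) : vPv R + vW (cst e) = vf 0 0 0 0 1 (cst e).
  by rewrite /vf !scale0r scale1r !(addr0, add0r).
have eWE (e : R) : vW (cst e) = vf 0 0 0 0 0 (cst e).
  by rewrite /vf !scale0r !(addr0, add0r).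
split.
  case=> [[a [b [d1 ->]]]|[[b [d1 [d2 ->]]]|[[d1 [d2 ->]]|[[d1 [d2 ->]]|
    [[d1 ->]|->]]]]].
  - by rewrite eDE; do 6!eexists; split; [left|].
  - by rewrite eGE; do 6!eexists; split; [right; left|].
  - by rewrite ePtE; do 6!eexists; split; [do 2!right; left|].
  - by rewrite ePxE; do 6!eexists; split; [do 3!right; left|].
  - by rewrite ePvE; do 6!eexists; split; [do 4!right; left|].
  - by rewrite eWE; do 6!eexists; split; [do 5!right|].
move=> [d [g [a [b [c [e [nf ->]]]]]]].
case: nf => [[-> -> -> /bitP[d1 ->]]
  |[[-> -> /bitP[d2 ->] -> /bitP[d1 ->]]
  |[[[-> ->] -> -> /bitP[d2 ->] /bitP[d1 ->]]
  |[[[-> ->] -> -> /bitP[d2 ->] /bitP[d1 ->]]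
  |[[[-> ->] -> -> -> /bitP[d1 ->]]
  |[[-> ->] -> -> -> ->]]]]]].
- by left; exists g, c, d1; rewrite eDE.
- by right; left; exists c, d1, d2; rewrite eGE.
- by do 2!right; left; exists d1, d2; rewrite ePtE.
- by do 3!right; left; exists d1, d2; rewrite ePxE.
- by do 4!right; left; exists d1; rewrite ePvE.
- by do 5!right; rewrite [in RHS]eWE.
Qed.

Theorem theorem13 (R : realType) :
  optimal_list1
    [set L : set (vfield R) |
       (exists (a b : R) (d1 : bool),
          L = line (vD R + a *: vG R + b *: vPv R + vW (cst d1%:R)))
    \/ (exists (b : R) (d1 d2 : bool),
          L = line (vG R + d2%:R *: vPt R + b *: vPv R + vW (cst d1%:R)))
    \/ (exists d1 d2 : bool,
          L = line (vPt R + d2%:R *: vPv R + vW (cst d1%:R)))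
    \/ (exists d1 d2 : bool,
          L = line (vPx R + d2%:R *: vPv R + vW (cst d1%:R)))
    \/ (exists d1 : bool, L = line (vPv R + vW (cst d1%:R)))
    \/ L = line (vW (cst 1))].
Proof.
split.
- by move=> L /normal_form_lineP[d [g [a [b [c [e [nf ->]]]]]]]; exact: one_dim_line.
- move=> L M /normal_form_lineP[d [g [a [b [c [e [nf ->]]]]]]].
  move=> /normal_form_lineP[d' [g' [a' [b' [c' [e' [nf' ->]]]]]]] LM I J.
  by move=> [_ _ I0] _ /(G_equivalent_line_normal_form nf nf' I0).
- move=> I L oiI /(G_equivalent_normal_form oiI).
  move=> [d [g [a [b [c [e [nf [J oiJ LJ]]]]]]]].
  exists (line (vf d g a b c (cst e))), J; split=> //.
  by apply/normal_form_lineP; do 6!eexists; split; first exact: nf.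
Qed.
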